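(* Let $q\in\mathbb N$. (i) The S-matrix $S(k)$ for all $k\in\mathbb S$ determines $V\in\mathcal J_q$ uniquely: if $V_1,V_2\in\mathcal J_q$ have the same S-matrix on $\mathbb S$, then $V_1=V_2$. (ii) Let $\zeta_j\in\mathbb C$, $j=1,\dots,q+1$, be distinct numbers. Then the values $\psi(\zeta_j)$, $j=1,\dots,q+1$, of the Jost matrix determine $V\in\mathcal J_q$ uniquely: if the Jost matrices $\psi_1,\psi_2$ of $V_1,V_2\in\mathcal J_q$ satisfy $\psi_1(\zeta_j)=\psi_2(\zeta_j)$ for all $j=1,\dots,q+1$, then $V_1=V_2$.
   Context: Let $d\ge1$, $\mathbf 1$ the identity $d\times d$ matrix, $\mathbb N=\{1,2,\dots\}$, $\mathbb S=\{k\in\mathbb C:|k|=1\}$. On $\ell^2(\mathbb N,\mathbb C^d)$ (with $y_0=0$ and $a_0=\mathbf 1$) consider $H=H_o+V$, $(H_oy)_x=y_{x-1}+y_{x+1}$, $(Vy)_x=(a_{x-1}-\mathbf 1)y_{x-1}+b_xy_x+(a_x-\mathbf 1)y_{x+1}$, with complex $d\times d$ matrices $a_x,b_x$. Class $\mathcal J_q$, $q\in\{2p-1,2p\}$, $p\in\mathbb N$: all $V$ with $a_x>0$ (positive definite) and $b_x=b_x^*$ for all $x\ge1$; $a_x=\mathbf 1$, $b_x=0$ for all $x>p$; and, if $q=2p-1$, $a_p=\mathbf 1$ and $\det b_p\ne0$, while if $q=2p$, $\det(\mathbf 1-a_p^2)\ne0$. Jost solution: $f_x(k)$, $x\ge0$,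 is the $d\times d$ matrix solution of $a_{x-1}f_{x-1}+a_xf_{x+1}+b_xf_x=(k+k^{-1})f_x$, $x\ge1$, with $f_x(k)=k^x\mathbf 1$ for all $x>p$. The Jost matrix is $\psi(k)=f_0(k)$, a matrix polynomial in $k\in\mathbb C$ of order $q$. The S-matrix is $S(k)=\psi(k)^{-1}\psi(\overline k)$, $k\in\mathbb S$ (at $k=\pm1$ understood through its meromorphic extension). *)

(* Defs.v *)
From HB Require Import structures.
From mathcomp Require Import all_boot all_order all_algebra.
From mathcomp Require Import complex.
From mathcomp Require Import all_classical all_reals all_analysis.
From mathcomp Require Import zify ring.

Set Implicit Arguments.
Unset Strict Implicit.
Unset Printing Implicit Defensive.

Import Order.TTheory GRing.Theory Num.Theory.
Import numFieldNormedType.Exports.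

Local Open Scope ring_scope.
Local Open Scope complex_scope.
Local Open Scope sesquilinear_scope.
Local Open Scope classical_set_scope.

(* The matrices a_x, b_x are indexed by nat; only b_x with x >= 1 is
   meaningful, and a_0 = 1 is part of [class_J]. *)
Record coefs (R : realType) (d : nat) := Coefs {
  ca : nat -> 'M[R[i]]_d;
  cb : nat -> 'M[R[i]]_d
}.

(* l^2({1,2,...}, C^d), as sequences extended by y_0 = 0. *)
Definition ell2 (R : realType) (d : nat) :=
  [set y : nat -> 'cV[R[i]]_d | y 0%N = 0 /\
     cvgn (series (fun x : nat => \sum_(i < d) ComplexField.Normc.normc (y x i 0) ^+ 2 : R))].

Definition opV (R : realType) (d : nat) (W : coefs R d)
    (y : nat -> 'cV[R[i]]_d) (x : nat) : 'cV[R[i]]_d :=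
  if x is x'.+1 then
    (ca W x' - 1%:M) *m y x' + cb W x *m y x + (ca W x - 1%:M) *m y x.+1
  else 0.

(* Equality of the perturbations V as operators on l^2; see [same_VP]. *)
Definition same_V (R : realType) (d : nat) (W1 W2 : coefs R d) : Prop :=
  forall y, ell2 y -> opV W1 y = opV W2 y.

Definition posdefmx (R : realType) (d : nat) (A : 'M[R[i]]_d) : Prop :=
  A \is hermsymmx /\
  forall v : 'cV[R[i]]_d, v != 0 -> 0 < (v ^t* *m A *m v) 0 0.

(* p is determined by q in {2p-1, 2p}: p = uphalf q, i.e. ceil (q / 2). *)
Definition class_J (R : realType) (d q : nat) (W : coefs R d) : Prop :=
  let p := uphalf q in
  [/\ ca W 0%N = 1%:M,
      forall x, (1 <= x)%N -> posdefmx (ca W x) /\ cb W x \is hermsymmx,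
      forall x, (p < x)%N -> ca W x = 1%:M /\ cb W x = 0 &
      if odd q then ca W p = 1%:M /\ \det (cb W p) != 0
      else \det (1%:M - ca W p *m ca W p) != 0].

(* [f] is the Jost solution x |-> f_x(k), for a fixed k != 0. *)
Definition jost_solution (R : realType) (d q : nat) (W : coefs R d)
    (k : R[i]) (f : nat -> 'M[R[i]]_d) : Prop :=
  (forall x, (1 <= x)%N ->
     ca W x.-1 *m f x.-1 + ca W x *m f x.+1 + cb W x *m f x
       = (k + k^-1) *: f x) /\
  (forall x, (uphalf q < x)%N -> f x = (k ^+ x)%:M).

Definition evalmx (R : realType) (d : nat) (P : 'M[{poly R[i]}]_d) (k : R[i]) :
    'M[R[i]]_d := map_mx (fun r : {poly R[i]} => r.[k]) P.

(* The Jost equation makes no sense at k = 0, where psi is defined as a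
   polynomial: psi is the matrix polynomial with psi(k) = f_0(k), k != 0. *)
Definition jost_matrix (R : realType) (d q : nat) (W : coefs R d)
    (psi : 'M[{poly R[i]}]_d) : Prop :=
  forall k : R[i], k != 0 ->
    exists2 f, jost_solution q W k f & evalmx psi k = f 0%N.

(* On |k| = 1 one has k^* = 1/k, so this is the meromorphic extension of S. *)
Definition smatrix_mero (R : realType) (d : nat) (psi : 'M[{poly R[i]}]_d)
    (z : R[i]) : 'M[R[i]]_d := invmx (evalmx psi z) *m evalmx psi z^-1.

(* psi(k) may be singular at k = 1, -1, where the value of S is the limit in the
   punctured plane of its meromorphic extension. *)
Definition smatrix (R : realType) (d : nat) (psi : 'M[{poly R[i]}]_d)
    (k : R[i]) : 'M[R[i]]_d :=
  if (k == 1) || (k == -1) then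
    lim ((smatrix_mero psi : R[i]^o -> 'M[R[i]^o]_d) @ (k : R[i]^o)^')
  else invmx (evalmx psi k) *m evalmx psi (Num.conj k).

Lemma delta_ell2 (R : realType) (d n : nat) (v : 'cV[R[i]]_d) : (0 < n)%N ->
  ell2 (fun x : nat => if x == n then v else 0).
Proof.
move=> n0; split; first by rewrite ltn_eqF.
set u := fun x : nat => _.
apply: (@is_cvg_near_cst _ _ (series u n.+1)).
exists n.+1 => // m /= nm; rewrite /series /= (big_cat_nat (n := n.+1)) //=.
rewrite [X in _ + X]big_nat_cond [X in _ + X]big1 ?addr0 // => x /andP[/andP[nx _] _].
rewrite /u big1 // => i _; rewrite gtn_eqF // mxE.
by rewrite ComplexField.Normc.normc0 expr0n.
Qed.

Lemma same_VP (R : realType) (d : nat) (W1 W2 : coefs R d) :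
  ca W1 0%N = 1%:M -> ca W2 0%N = 1%:M ->
  same_V W1 W2 <->
  (forall x, (1 <= x)%N -> ca W1 x = ca W2 x /\ cb W1 x = cb W2 x).
Proof.
move=> a1 a2; split => [H x x1|H y _]; last first.
  apply/funext => -[//|x] /=; have [-> ->] := H x.+1 isT.
  by case: x => [|x]; rewrite ?a1 ?a2 //; have [-> _] := H x.+1 isT.
have mulP (A B : 'M[R[i]]_d) : (forall v : 'cV_d, A *m v = B *m v) -> A = B.
  move=> AB; apply/matrixP => i j; have := congr1 (fun M : 'cV_d => M i 0) (AB (delta_mx j 0)).
  by rewrite -!colE !mxE.
have aE z : ca W1 z = ca W2 z.
  elim: z => [|z _]; first by rewrite a1 a2.
  apply: mulP => v.
  have /(congr1 (fun f => f z.+1))/= := H _ (@delta_ell2 R d z.+2 v isT).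
  rewrite (ltn_eqF (ltnSn _)) (ltn_eqF (ltnW (ltnSn z.+1))) eqxx.
  by rewrite !mulmx0 !add0r !mulmxBl => /addIr.
split=> //; apply: mulP => v.
have := H _ (@delta_ell2 R d x v x1) => /(congr1 (fun f => f x)).
case: x x1 => [//|x] _ /=; rewrite eqxx aE.
by rewrite ltn_eqF // gtn_eqF // !mulmx0 !add0r !addr0.
Qed.

Lemma posdefmx_unit (R : realType) (d : nat) (A : 'M[R[i]]_d) :
  posdefmx A -> A \in unitmx.
Proof.
move=> [_ Apos]; rewrite unitmxE unitfE; apply/det0P => -[v v0 vA].
have w0 : v ^t* != 0.
  apply: contra v0 => /eqP/(congr1 (fun M => M ^t* )).
  by rewrite trmxCK => ->; rewrite trmx0 map_mx0.
by have := Apos _ w0; rewrite trmxCK vA mul0mx mxE ltxx.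
Qed.

Lemma jost_solution_inj (R : realType) (d q : nat) (W : coefs R d) (k : R[i])
    (f g : nat -> 'M[R[i]]_d) :
  class_J q W -> jost_solution q W k f -> jost_solution q W k g -> f = g.
Proof.
move=> [a0 ab _ _] [f1 f2] [g1 g2].
have aU x : ca W x \in unitmx.
  case: x => [|x]; first by rewrite a0 unitmx1.
  by apply: posdefmx_unit; case: (ab x.+1 isT).
suff H n : forall x, ((uphalf q).+1 - n <= x)%N -> f x = g x.
  by apply/funext => x; apply: (H (uphalf q).+1); rewrite subnn.
elim: n => [|n IHn] x; first by rewrite subn0 => qx; rewrite f2 // g2.
have [nx _|xn hx] := leqP ((uphalf q).+1 - n) x; first exact: IHn.
have Hx1 : f x.+1 = g x.+1 by apply: IHn; lia.
have Hx2 : f x.+2 = g x.+2 by apply: IHn; lia.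
have := f1 x.+1 isT; rewrite Hx1 Hx2 -(g1 x.+1 isT) /= => /addIr/addIr.
by move/(congr1 (mulmx (invmx (ca W x)))); rewrite !mulKmx.
Qed.

Lemma jost_matrix_inj (R : realType) (d q : nat) (W : coefs R d)
    (psi1 psi2 : 'M[{poly R[i]}]_d) :
  class_J q W -> jost_matrix q W psi1 -> jost_matrix q W psi2 -> psi1 = psi2.
Proof.
move=> JW H1 H2; apply/matrixP => i j; apply/eqP; rewrite -subr_eq0.
set r : {poly R[i]} := (X in X == 0); apply/eqP.
pose rs := [seq m.+1%:R : R[i] | m <- iota 0 (size r)].
apply: (@roots_geq_poly_eq0 _ r rs); last by rewrite size_map size_iota.
  apply/allP => _ /mapP[m _ ->]; have k0 : m.+1%:R != 0 :> R[i] by rewrite pnatr_eq0.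
  have [f fJ fE] := H1 _ k0; have [g gJ gE] := H2 _ k0.
  have := congr1 (fun M : 'M[R[i]]_d => M i j) fE; rewrite (jost_solution_inj JW fJ gJ) -gE !mxE.
  by move=> E; rewrite /root /r hornerD hornerN E subrr.
by rewrite map_inj_uniq ?iota_uniq // => m n /eqP; rewrite eqr_nat => /eqP[].
Qed.

Fixpoint jost_rec (R : realType) (d p : nat) (W : coefs R d) (n : nat) :
    'M[{poly R[i]}]_d * 'M[{poly R[i]}]_d :=
  if n is n'.+1 then
    let x := (p.+1 - n')%N in
    let g := jost_rec p W n' in
    (map_mx polyC (invmx (ca W x.-1)) *m
       ((1 + 'X ^+ 2) *: g.1 - 'X *: (map_mx polyC (cb W x) *m g.1)
        - 'X ^+ 2 *: (map_mx polyC (ca W x) *m g.2)), g.1)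
  else (1%:M, 1%:M).

(* k ^+ x *: g_x(k) is the Jost solution, with g_x the polynomials below. *)
Lemma jost_matrix_exists (R : realType) (d q : nat) (W : coefs R d) :
  class_J q W -> exists psi, jost_matrix q W psi.
Proof.
move=> [a0 ab abp _]; set p := uphalf q in abp.
have aU x : ca W x \in unitmx.
  case: x => [|x]; first by rewrite a0 unitmx1.
  by apply: posdefmx_unit; case: (ab x.+1 isT).
pose g x := (jost_rec p W (p.+1 - x)).1.
have gE n : (n <= p)%N -> (jost_rec p W n).2 = g (p.+2 - n)%N.
  case: n => [|n] np; first by rewrite /g (_ : _ - _ = 0)%N //; lia.
  by rewrite /g /= (_ : p.+1 - _ = n)%N //; lia.
exists (g 0%N) => k k0.
exists (fun x => k ^+ x *: evalmx (g x) k); last by rewrite expr0 scale1r.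
have ev1 : evalmx 1%:M k = 1%:M :> 'M[R[i]]_d.
  exact: (map_mx1 (horner_eval k)).
have evC (A : 'M[R[i]]_d) : evalmx (map_mx polyC A) k = A.
  by apply/matrixP => i j; rewrite !mxE hornerC.
have evM (A B : 'M[{poly R[i]}]_d) : evalmx (A *m B) k = evalmx A k *m evalmx B k.
  exact: (map_mxM (horner_eval k)).
have evB (A B : 'M[{poly R[i]}]_d) : evalmx (A - B) k = evalmx A k - evalmx B k.
  by apply/matrixP => i j; rewrite !mxE hornerD hornerN.
have evZ c (A : 'M[{poly R[i]}]_d) : evalmx (c *: A) k = c.[k] *: evalmx A k.
  by apply/matrixP => i j; rewrite !mxE hornerM.
have gp x : (p < x)%N -> g x = 1%:M.
  by move=> px; rewrite /g (_ : _ - _ = 0)%N //; lia.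
split => [[//|x] _ /=|x px]; last by rewrite gp // ev1 scale_scalar_mx mulr1.
have kx2 : k ^+ x.+1 * (k + k^-1) = k ^+ x * (1 + k ^+ 2).
  by rewrite exprS; field.
have [px|xp] := ltnP p x.
  have [-> _] := abp _ px; have [-> ->] := abp x.+1 (ltnW px).
  rewrite !mul1mx mul0mx addr0 !gp ?ev1 //; try lia.
  rewrite -scalerDl scalerA [_ * k ^+ _]mulrC kx2; congr (_ *: _).
  by rewrite mulrDr mulr1 -exprD addn2.
have nx : (p.+1 - x = (p - x).+1)%N by lia.
have -> : g x = map_mx polyC (invmx (ca W x)) *m
       ((1 + 'X ^+ 2) *: g x.+1 - 'X *: (map_mx polyC (cb W x.+1) *m g x.+1)
        - 'X ^+ 2 *: (map_mx polyC (ca W x.+1) *m g x.+2)).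
  rewrite {1}/g nx /= gE ?leq_subr // (_ : p.+1 - (p - x) = x.+1)%N; last lia.
  rewrite (_ : p.+2 - (p - x) = x.+2)%N; last lia.
  by rewrite /g subSS.
rewrite evM evC -scalemxAr mulKVmx //.
rewrite !evB !evZ !evM !evC !hornerE scalerA [_ * k ^+ x.+1]mulrC kx2 -!scalemxAr.
rewrite !scalerBr !scalerA -exprD addn2 -exprSr.
set A := _ *: evalmx _ _; set B := _ *: (cb _ _ *m _); set C := _ *: (ca _ _ *m _).
by rewrite subrK subrK.
Qed.

(* Main.v *)
(* Write [f_x(k)] for the Jost solution and [P#(k) = P(conj k)^*].  Constancy of
   the Wronskian gives [f_0# f_1 = f_1# f_0] and
   [f_0#(1/k) f_1(k) - f_1#(1/k) f_0(k) = k - 1/k]; inverting the block matrix of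
   these relations gives the Bezout identity
   [f_0(1/k) f_1#(k) - f_0(k) f_1#(1/k) = k - 1/k].

   If two S-matrices agree, [M = psi_2 psi_1^-1] is invariant under [k -> 1/k].
   By the Bezout identity, [(k - 1/k) M(k)] is a Laurent polynomial; it is odd
   under [k -> 1/k] and of order at least -1 at 0, where [psi_1] is invertible.
   Hence [M] is a constant [C], and bound states need no separate treatment.
   The same argument applied to [(C^* f'_1 - f_1) psi_1^-1], which vanishes at 0,
   gives [C^* f'_1 = f_1], where [f'] is the Jost solution of [V_2].  Then [C] is
   unitary, and the recursion started at [x = 0] shows that
   [f'_x = C f_x], [a'_x = C a_x C^*] and [b'_x = C b_x C^*] for all [x]; as
   [f'_x = f_x] for large [x], [C = 1].

   In (ii), [psi] has degree at most [q], so interpolation gives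
   [psi_1 = psi_2]. *)

Require Import Defs.
From mathcomp Require Import all_boot all_order all_algebra.
From mathcomp Require Import complex.
From mathcomp Require Import all_classical all_reals all_analysis.
From mathcomp Require Import zify ring.

Set Implicit Arguments.
Unset Strict Implicit.
Unset Printing Implicit Defensive.

Import Order.TTheory GRing.Theory Num.Theory.

Local Open Scope ring_scope.
Local Open Scope sesquilinear_scope.

Local Notation constmx := (map_mx polyC).

(** * Matrix polynomials: evaluation, dense sets of points, symmetry under [k -> k^-1] *)

Lemma evalmxM (R : realType) d (P Q : 'M[{poly R[i]}]_d) k :
  evalmx (P *m Q) k = evalmx P k *m evalmx Q k.
Proof. exact: (map_mxM (horner_eval k)). Qed.

Lemma evalmxD (R : realType) d (P Q : 'M[{poly R[i]}]_d) k :
  evalmx (P + Q) k = evalmx P k + evalmx Q k.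
Proof. exact: (map_mxD (horner_eval k)). Qed.

Lemma evalmxB (R : realType) d (P Q : 'M[{poly R[i]}]_d) k :
  evalmx (P - Q) k = evalmx P k - evalmx Q k.
Proof. exact: (map_mxB (horner_eval k)). Qed.

Lemma evalmxZ (R : realType) d r (P : 'M[{poly R[i]}]_d) k :
  evalmx (r *: P) k = r.[k] *: evalmx P k.
Proof. exact: (map_mxZ (horner_eval k)). Qed.

Lemma evalmx1 (R : realType) d k : evalmx (1%:M : 'M[{poly R[i]}]_d) k = 1%:M.
Proof. exact: (map_mx1 (horner_eval k)). Qed.

Lemma evalmxC (R : realType) d (A : 'M[R[i]]_d) k : evalmx (constmx A) k = A.
Proof. by apply/matrixP => i j; rewrite !mxE hornerC. Qed.

(** On the complex line this means that [P] is infinite. In this form, the zeros of a given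
    polynomial are removed from [P] by testing against a product with it. *)
Definition zariski_dense (R : realType) (P : R[i] -> Prop) :=
  forall D : {poly R[i]}, D != 0 -> exists2 k, P k & D.[k] != 0.

Lemma zariski_denseI (R : realType) (P : R[i] -> Prop) (D : {poly R[i]}) :
  D != 0 -> zariski_dense P -> zariski_dense (fun k => P k /\ D.[k] != 0).
Proof.
move=> D0 Pd E E0; have [] := Pd (D * E); first by rewrite mulf_neq0.
move=> k Pk; rewrite hornerM mulf_eq0 negb_or => /andP[Dk Ek].
by exists k.
Qed.

Lemma sub_zariski_dense (R : realType) (P Q : R[i] -> Prop) :
  (forall k, P k -> Q k) -> zariski_dense P -> zariski_dense Q.
Proof. by move=> PQ Pd D /Pd[k /PQ Qk Dk]; exists k. Qed.

Lemma zariski_dense_seq (R : realType) (z : nat -> R[i]) :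
  injective z -> zariski_dense (fun k => exists n, k = z n).
Proof.
move=> zI D; apply: contraNP => Dz; apply/eqP.
apply: (@roots_geq_poly_eq0 _ D [seq z n | n <- iota 0 (size D)]).
- apply/allP => _ /mapP[n _ ->]; apply/rootP/eqP; apply: contra_notT Dz => Dn.
  by exists (z n) => //; exists n.
- by rewrite map_inj_uniq ?iota_uniq.
- by rewrite size_map size_iota.
Qed.

Lemma zariski_dense_eqmx (R : realType) d (P : R[i] -> Prop) (A B : 'M[{poly R[i]}]_d) :
  zariski_dense P -> (forall k, P k -> evalmx A k = evalmx B k) -> A = B.
Proof.
move=> Pd AB; apply/matrixP => i j; apply/eqP; rewrite -subr_eq0.
apply: contraT => /Pd[k Pk]; rewrite hornerD hornerN.
by have /matrixP/(_ i j) := AB _ Pk; rewrite !mxE => ->; rewrite subrr eqxx.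
Qed.

Lemma horner_inv_rev (R : realType) (r : {poly R[i]}) n k :
  (size r <= n.+1)%N -> k != 0 ->
  (\poly_(i < n.+1) r`_(n - i)).[k] = k ^+ n * r.[k^-1].
Proof.
move=> rn k0; rewrite horner_poly (horner_coef_wide _ rn) mulr_sumr.
rewrite (reindex_inj rev_ord_inj); apply: eq_bigr => i _ /=.
have ni : (i <= n)%N by rewrite -ltnS.
rewrite subSS subKn // mulrCA exprVn; congr (_ * _).
have -> : k ^+ n = k ^+ (n - i) * k ^+ i by rewrite -exprD subnK.
by rewrite mulfK // expf_neq0.
Qed.

(** Reversing coefficients clears the denominators of [A(1/k)]; one [n] serves all entries, so the
    factor is scalar. *)
Lemma evalmx_inv_rev (R : realType) d (A : 'M[{poly R[i]}]_d) :
  exists n, exists B : 'M[{poly R[i]}]_d,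
    forall k : R[i], k != 0 -> evalmx B k = k ^+ n *: evalmx A k^-1.
Proof.
pose n := (\max_i \max_j size (A i j))%N.
exists n, (\matrix_(i, j) \poly_(m < n.+1) (A i j)`_(n - m)) => k k0.
apply/matrixP => i j; rewrite !mxE horner_inv_rev //.
apply: leqW.
apply: leq_trans (leq_bigmax (F := fun i => \max_j size (A i j))%N i).
exact: (leq_bigmax (F := fun j => size (A i j)) j).
Qed.

(* [k^-1 r(k)] is a Laurent polynomial odd under [k -> k^-1] and of order at
   least -1 at 0, hence a multiple of [k - k^-1]. *)
Lemma odd_laurent (R : realType) (P : R[i] -> Prop) (r : {poly R[i]}) :
  zariski_dense P -> (forall k, P k -> k != 0 -> r.[k] = - (k ^+ 2 * r.[k^-1])) ->
  r = r`_2 *: ('X ^+ 2 - 1).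
Proof.
move=> Pd rP; set n := size r.
pose s := \poly_(i < n.+1) r`_(n - i).
have E : 'X^n * r = - ('X^2 * s).
  apply/eqP; rewrite -subr_eq0; apply: contraT => E0.
  have [k [Pk]] := zariski_denseI (negbT (polyX_eq0 _)) Pd E0.
  rewrite hornerX => k0; rewrite !hornerE horner_inv_rev // (rP _ Pk k0).
  by rewrite [X in X != 0](_ : _ = 0) ?eqxx //; ring.
(* As [s] has coefficient [r_(n-j)] at [j <= n], this reads [r_i = - r_(2-i)]: so [r_0 = - r_2],
   [r_1 = 0], and [r_i = 0] for [i > 2]. *)
have cE i : r`_i = - (if (n + i < 2)%N then 0 else s`_(n + i - 2)).
  have := congr1 (fun p : {poly _} => p`_(n + i)) E.
  rewrite coefXnM ltnNge leq_addr /= addKn => ->.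
  by rewrite coefN coefXnM.
have rn i : (n <= i)%N -> r`_i = 0 by exact: nth_default.
move: cE rn; rewrite /s; clear s E; clearbody n; clear.
move=> cE rn; have r0 : r`_0 = - r`_2.
  rewrite [LHS]cE addn0 coef_poly; case: ltnP => n2.
    by rewrite rn ?oppr0 // ltnW.
  by rewrite ltnS leq_subr subKn.
have r1 : r`_1 = 0.
  have [n0|n0] := posnP n; first by rewrite rn ?n0.
  have := cE 1%N; rewrite addn1 ltnS ltnNge n0 coef_poly subSS ltnS leq_subr.
  by rewrite subKn // => /eqP; rewrite -addr_eq0 -mulr2n mulrn_eq0 /= => /eqP.
apply/polyP => -[|[|[|i]]]; rewrite coefZ coefB coefXn coef1 /= ?subr0.
- by rewrite sub0r mulrN1.
- by rewrite mulr0.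
- by rewrite mulr1.
by rewrite mulr0 cE coef_poly !ifF ?oppr0 //; lia.
Qed.

(* [(k - k^-1) M(k) = k X(k^-1) G(k) - k^-1 X(k) G(k^-1)] is a Laurent
   polynomial, odd under [k -> k^-1]; its order at 0 is at least -1 because
   [psi(0)] is invertible.  So it is a multiple of [k - k^-1]. *)
Lemma reflection_rigidity (R : realType) d (P : R[i] -> Prop)
    (psi G X : 'M[{poly R[i]}]_d) :
  zariski_dense P -> evalmx psi 0 \in unitmx ->
  (forall k, P k -> [/\ k != 0, k ^+ 2 != 1 &
     k *: (evalmx psi k^-1 *m evalmx G k) - k^-1 *: (evalmx psi k *m evalmx G k^-1)
       = (k - k^-1)%:M]) ->
  (forall k, P k -> exists2 M,
     evalmx X k = M *m evalmx psi k & evalmx X k^-1 = M *m evalmx psi k^-1) ->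
  exists C, X = constmx C *m psi.
Proof.
move=> Pd psi0 bez XM.
pose L (k : R[i]) : 'M[R[i]]_d :=
  k *: (evalmx X k^-1 *m evalmx G k) - k^-1 *: (evalmx X k *m evalmx G k^-1).
(* [X(k)] and [X(1/k)] share the left factor [M], which comes out of [L] and leaves the Bezout
   identity. *)
have LE k : P k -> exists2 M, L k = (k - k^-1) *: M & evalmx X k = M *m evalmx psi k.
  move=> Pk; have [M X1 X2] := XM k Pk; have [_ _] := bez k Pk.
  rewrite !scalemxAr => B; exists M => //.
  by rewrite /L X1 X2 -!mulmxA !scalemxAr -mulmxBr B mul_mx_scalar.
have LN (k : R[i]) : L k^-1 = - L k by rewrite /L invrK opprB.
have [n [Xr XrE]] := evalmx_inv_rev X.
have [m [Gr GrE]] := evalmx_inv_rev G.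
(* This is [k^(n+m+1) L(k)], since [X(1/k) = k^-n Xr(k)] and [G(1/k) = k^-m Gr(k)]. *)
pose N : 'M[{poly R[i]}]_d := 'X^(2 + m) *: (Xr *m G) - 'X^n *: (X *m Gr).
have NE (k : R[i]) : k != 0 -> evalmx N k = k ^+ (n + m).+1 *: L k.
  move=> k0; rewrite /N evalmxB !evalmxZ !evalmxM XrE // GrE // !hornerE.
  rewrite -scalemxAl -scalemxAr !scalerA scalerBr !scalerA; congr (_ *: _ - _ *: _).
    by rewrite addSn addSn add0n !exprS exprD; ring.
  by rewrite exprS exprD mulrAC mulfV // mul1r.
have NX : N *m psi = ('X^(n + m) * ('X^2 - 1)) *: X.
  apply: (zariski_dense_eqmx Pd) => k Pk; have [k0 _ _] := bez k Pk.
  have [M LM XE] := LE k Pk; rewrite evalmxM NE // LM evalmxZ XE !hornerE.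
  rewrite -!scalemxAl scalerA; congr (_ *: _); rewrite exprS; field.
  by [].
clearbody L N.
(* The bound on the order at 0: by [NX] and the adjugate, ['X^(n + m)] divides each entry of [N]
   times [\det psi], which is coprime to ['X] because [psi(0)] is invertible. *)
have [Q QE] : exists Q : 'M[{poly R[i]}]_d, N = 'X^(n + m) *: Q.
  have dvd i j : 'X^(n + m) %| N i j.
    have : 'X^(n + m) %| (N i j) * \det psi.
      have := congr1 (mulmx^~ (\adj psi)) NX.
      rewrite -mulmxA mul_mx_adj -scalemxAl mul_mx_scalar.
      move=> /matrixP/(_ i j); rewrite !mxE mulrC => ->.
      by rewrite -mulrA dvdp_mulr.
    rewrite Gauss_dvdpl // coprimep_expl // coprimep_sym coprimepX /root.
    by rewrite -horner_evalE -det_map_mx -unitfE -unitmxE.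
  exists (\matrix_(i, j) (N i j %/ 'X^(n + m))).
  by apply/matrixP => i j; rewrite !mxE mulrC divpK.
have QL (k : R[i]) : k != 0 -> evalmx Q k = k *: L k.
  move=> k0; have := NE k k0; rewrite QE evalmxZ !hornerE exprSr -scalerA.
  by move/(scalerI (expf_neq0 _ k0)) => ->.
pose C : 'M[R[i]]_d := \matrix_(i, j) (Q i j)`_2.
have QC : Q = ('X^2 - 1) *: constmx C.
  apply/matrixP => i j; rewrite !mxE [LHS](@odd_laurent _ _ (Q i j) Pd).
    by rewrite -mul_polyC mulrC.
  move=> k _ k0.
  have ev x : (Q i j).[x] = evalmx Q x i j by rewrite mxE.
  rewrite !ev !QL ?invr_eq0 // LN scalerN !mxE; field.
  by [].
exists C; apply: (zariski_dense_eqmx Pd) => k Pk; have [k0 k2 _] := bez k Pk.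
have k21 : ('X^2 - 1 : {poly R[i]}).[k] != 0 by rewrite !hornerE subr_eq0.
apply: (scalerI k21); rewrite -evalmxZ.
apply: (@scalerI _ _ (k ^+ (n + m))); first by rewrite expf_neq0.
have -> : k ^+ (n + m) = 'X^(n + m).[k] by rewrite !hornerE.
by rewrite -evalmxZ scalerA -NX QE QC -evalmxZ -evalmxZ -!scalemxAl.
Qed.

(** * Jost polynomials and the Bezout identity *)

Lemma subr_cross (V : zmodType) (a b c e : V) : a - b - c - (a - e - c) = e - b.
Proof. by rewrite opprB addrA subrK opprB addrC addrA subrK. Qed.

(** Conjugating the coefficients keeps [P#] a polynomial in [k]; at real [k] it is the adjoint of
    [P(k)]. *)
Definition sharpmx (R : realType) d (P : 'M[{poly R[i]}]_d) : 'M[{poly R[i]}]_d :=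
  (map_mx (map_poly Num.conj) P)^T.

Lemma evalmx_sharp (R : realType) d (P : 'M[{poly R[i]}]_d) k :
  evalmx (sharpmx P) k = (evalmx P (Num.conj k)) ^t*.
Proof.
by apply/matrixP => i j; rewrite !mxE -{1}[k]conjCK horner_map.
Qed.

(* The Jost solution is [k ^+ x *: g_x(k)]. *)
Definition jost_poly (R : realType) d p (W : coefs R d)
    (g : nat -> 'M[{poly R[i]}]_d) : Prop :=
  (forall x, (p < x)%N -> g x = 1%:M) /\
  forall x, constmx (ca W x) *m g x
     + 'X^2 *: (constmx (ca W x.+1) *m g x.+2)
     + 'X *: (constmx (cb W x.+1) *m g x.+1) = (1 + 'X^2) *: g x.+1.

Lemma trmxC_mul (R : realType) m n p (A : 'M[R[i]]_(m, n)) (B : 'M[R[i]]_(n, p)) :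
  (A *m B) ^t* = B ^t* *m A ^t*.
Proof. by rewrite trmx_mul map_mxM. Qed.

Lemma trmxC_add (R : realType) m n (A B : 'M[R[i]]_(m, n)) :
  (A + B) ^t* = A ^t* + B ^t*.
Proof. by rewrite linearD map_mxD. Qed.

Lemma trmxC_sub (R : realType) m n (A B : 'M[R[i]]_(m, n)) :
  (A - B) ^t* = A ^t* - B ^t*.
Proof. by rewrite linearB map_mxB. Qed.

Lemma trmxC_scale (R : realType) m n a (A : 'M[R[i]]_(m, n)) :
  (a *: A) ^t* = Num.conj a *: A ^t*.
Proof. by rewrite linearZ map_mxZ. Qed.

Lemma hermsymmxE (R : realType) d (A : 'M[R[i]]_d) : A \is hermsymmx -> A ^t* = A.
Proof. by move=> /is_hermitianmxP; rewrite expr0 scale1r => <-. Qed.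

Lemma class_J_unit (R : realType) d q (W : coefs R d) x :
  class_J q W -> ca W x \in unitmx.
Proof.
move=> [a0 ab _ _]; case: x => [|x]; first by rewrite a0 unitmx1.
by apply: posdefmx_unit; case: (ab x.+1 isT).
Qed.

Lemma class_J_herm (R : realType) d q (W : coefs R d) x :
  class_J q W -> (ca W x) ^t* = ca W x /\ (cb W x.+1) ^t* = cb W x.+1.
Proof.
move=> [a0 ab _ _]; split; last by case: (ab x.+1 isT) => _ /hermsymmxE.
case: x => [|x]; first by rewrite a0 trmx1 map_mx1.
by case: (ab x.+1 isT) => -[/hermsymmxE].
Qed.

(** Downward recursion: since [ca W x] is invertible, the relation at [x] can be solved for
    [g x]. *)
Lemma jost_poly_exists (R : realType) d q (W : coefs R d) :
  class_J q W -> exists g, jost_poly (uphalf q) W g.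
Proof.
move=> JW; have [_ _ abp _] := JW; set p := uphalf q in abp *.
suff /(_ p.+1) [g [gp gE]] m : exists g : nat -> 'M[{poly R[i]}]_d,
    (forall x, (p < x)%N -> g x = 1%:M) /\
    forall x, (p.+1 - m <= x)%N -> constmx (ca W x) *m g x
     + 'X^2 *: (constmx (ca W x.+1) *m g x.+2)
     + 'X *: (constmx (cb W x.+1) *m g x.+1) = (1 + 'X^2) *: g x.+1.
  by exists g; split=> // x; apply: gE; rewrite subnn.
elim: m => [|m [g [gp gE]]].
  exists (fun=> 1%:M); split=> // x; rewrite subn0 => px.
  have [-> _] := abp _ px; have [-> ->] := abp _ (ltnW px : (p < x.+1)%N).
  by rewrite map_mx1 map_mx0 !mul1mx mul0mx scaler0 addr0 scalerDl scale1r.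
(* When [p < m], the truncated [p.+1 - m] is already 0 and every relation holds. *)
have [pm|mp] := ltnP p m.
  by exists g; split=> // x _; apply: gE; move: pm; clear; lia.
pose h x := if x == (p - m)%N then constmx (invmx (ca W x)) *m
  ((1 + 'X^2) *: g x.+1 - 'X *: (constmx (cb W x.+1) *m g x.+1)
    - 'X^2 *: (constmx (ca W x.+1) *m g x.+2)) else g x.
have hE x : (p - m < x)%N -> h x = g x by rewrite /h; case: eqP => // ->; rewrite ltnn.
exists h; split=> [x px|x].
  by rewrite hE ?gp // (leq_ltn_trans _ px) // leq_subr.
rewrite subSS leq_eqVlt => /orP[/eqP xE|mx].
  rewrite [h x.+1]hE ?[h x.+2]hE ?xE ?ltnS ?leqnSn // /h xE eqxx.
  by rewrite mulmxA -map_mxM mulmxV ?(class_J_unit _ JW) // map_mx1 mul1mx !subrK.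
by rewrite !hE //; [apply: gE; rewrite subSn|apply: ltnW|apply: ltnW; apply: ltnW].
Qed.

Lemma jost_poly_at0 (R : realType) d p (W : coefs R d) g x :
  jost_poly p W g -> evalmx (g x.+1) 0 = ca W x *m evalmx (g x) 0.
Proof.
move=> [_ gE]; have := congr1 (fun P => evalmx P 0) (gE x).
rewrite !evalmxD !evalmxZ !evalmxM !evalmxC !hornerE.
by rewrite expr0n !scale0r !addr0 scale1r => ->.
Qed.

(** At [k = 0] passing from [x] to [x.+1] is multiplication by the invertible [ca W x], and [g] is
    the identity beyond [p]. *)
Lemma jost_poly_unit (R : realType) d q (W : coefs R d) g x :
  class_J q W -> jost_poly (uphalf q) W g -> evalmx (g x) 0 \in unitmx.
Proof.
move=> JW Jg; have [gp _] := Jg; set p := uphalf q in gp.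
suff: evalmx (g (x + p.+1)%N) 0 \in unitmx.
  elim: p.+1 => [|n IHn]; first by rewrite addn0.
  by rewrite addnS (jost_poly_at0 _ Jg) unitmx_mul (class_J_unit _ JW).
by rewrite gp ?evalmx1 ?unitmx1 // leq_addl.
Qed.

Lemma jost_poly_solution (R : realType) d q (W : coefs R d) g (k : R[i]) :
  jost_poly (uphalf q) W g -> k != 0 ->
  jost_solution q W k (fun x => k ^+ x *: evalmx (g x) k).
Proof.
move=> [gp gE] k0; split=> [[//|x] _ /=|x px]; last first.
  by rewrite gp // evalmx1 scale_scalar_mx mulr1.
have := congr1 (fun P => k ^+ x *: evalmx P k) (gE x).
rewrite /= !evalmxD !evalmxZ !evalmxM !evalmxC !hornerE !scalerDr -!scalemxAr !scalerA.
rewrite -!exprD -exprSr addn2 => ->.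
by congr (_ *: _); rewrite [in RHS]exprS; field.
Qed.

Lemma jost_matrix_poly (R : realType) d q (W : coefs R d) g psi :
  class_J q W -> jost_poly (uphalf q) W g -> jost_matrix q W psi -> psi = g 0%N.
Proof.
move=> JW Jg Jpsi; apply: (jost_matrix_inj JW Jpsi) => k k0.
by eexists; [exact: jost_poly_solution Jg k0|rewrite /= expr0 scale1r].
Qed.

(* Constancy of the Wronskian, compared at [x = 0] and at infinity. *)
Lemma jost_wronskian (R : realType) d q (W : coefs R d) g (k l : R[i]) :
  class_J q W -> jost_poly (uphalf q) W g -> k != 0 -> l != 0 ->
  l + l^-1 = k + k^-1 ->
  k *: (evalmx (sharpmx (g 0%N)) l *m evalmx (g 1%N) k)
    - l *: (evalmx (sharpmx (g 1%N)) l *m evalmx (g 0%N) k)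
  = ((l * k) ^+ (uphalf q).+1 * (k - l))%:M.
Proof.
move=> JW Jg k0 l0 lk; rewrite !evalmx_sharp.
(* The adjoint of the Jost solution at [conj l] solves the row equation at [l], whose spectral
   parameter [l + 1/l] equals that of [v]. *)
set m := Num.conj l.
have m0 : m != 0 by rewrite conjC_eq0.
pose F h x := h ^+ x *: evalmx (g x) h; pose v := F k; pose u := F m.
have mE : Num.conj (m + m^-1) = k + k^-1 by rewrite rmorphD fmorphV /= conjCK.
have [vE vp] : jost_solution q W k v := jost_poly_solution Jg k0.
have [uE up] : jost_solution q W m u := jost_poly_solution Jg m0.
have F0 h : F h 0%N = evalmx (g 0%N) h by rewrite /F expr0 scale1r.
have F1 h : F h 1%N = h *: evalmx (g 1%N) h by rewrite /F expr1.
move: (F0 k) (F1 k) (F0 m) (F1 m); rewrite -/u -/v => v0E v1E u0E u1E.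
clearbody u v.
pose w x := (u x) ^t* *m (ca W x *m v x.+1) - (u x.+1) ^t* *m (ca W x *m v x).
(* After eliminating the values at [x.+2], the spectral terms and the terms in [cb] cancel, the
   coefficients being hermitian. *)
have wS x : w x.+1 = w x.
  have v2 : ca W x.+1 *m v x.+2 =
      (k + k^-1) *: v x.+1 - ca W x *m v x - cb W x.+1 *m v x.+1.
    by rewrite -(vE x.+1 isT) /= addrAC addrK addrAC subrr add0r.
  have u2 : (u x.+2) ^t* *m ca W x.+1 =
      (k + k^-1) *: (u x.+1) ^t* - (u x) ^t* *m ca W x - (u x.+1) ^t* *m cb W x.+1.
    have [a1 _] := class_J_herm x.+1 JW; have [a b] := class_J_herm x JW.
    have := congr1 (fun M => M ^t*) (uE x.+1 isT).
    rewrite /= !trmxC_add !trmxC_mul a1 a b trmxC_scale.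
    rewrite mE => <-.
    by rewrite addrAC addrK addrAC subrr add0r.
  rewrite /w !mulmxA u2 -mulmxA v2 !mulmxBr !mulmxBl -!scalemxAl -!scalemxAr !mulmxA.
  exact: subr_cross.
have wE n : w n = w 0%N by elim: n => [|n <-]; [reflexivity|exact: wS].
have [a0 _ abp _] := JW; have [ap _] := abp _ (ltnSn (uphalf q)).
have lE : l = Num.conj m by rewrite conjCK.
have mX n : Num.conj (m ^+ n) = l ^+ n by rewrite rmorphXn /= -lE.
transitivity (w 0%N).
  by rewrite /w a0 !mul1mx u0E u1E v0E v1E trmxC_scale -lE -scalemxAl scalemxAr.
have hs a b : (a%:M) ^t* *m (1%:M *m b%:M) = (Num.conj a * b)%:M :> 'M[R[i]]_d.
  by rewrite mul1mx tr_scalar_mx map_scalar_mx -scalar_mxM.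
(* At [n = p + 1] both solutions are free and [w] equals [l^n k^(n+1) - l^(n+1) k^n]. *)
rewrite -(wE (uphalf q).+1) /w ap (up _ (ltnSn _)) (vp _ (ltnSn _)).
rewrite (up _ (ltnW (ltnSn _.+1))) (vp _ (ltnW (ltnSn _.+1))) !hs !mX.
rewrite -raddfB; congr (_%:M); move: (uphalf q).+1 => n.
by rewrite exprMn !exprS; ring.
Qed.

Lemma jost_bezout (R : realType) d q (W : coefs R d) g (k : R[i]) :
  class_J q W -> jost_poly (uphalf q) W g -> k != 0 -> k ^+ 2 != 1 ->
  k *: (evalmx (g 0%N) k^-1 *m evalmx (sharpmx (g 1%N)) k)
    - k^-1 *: (evalmx (g 0%N) k *m evalmx (sharpmx (g 1%N)) k^-1)
  = (k - k^-1)%:M.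
Proof.
move=> JW Jg k0 k2; have i0 : k^-1 != 0 by rewrite invr_eq0.
have kC : k + k^-1 = k^-1 + k^-1^-1 by rewrite invrK addrC.
have c0 : k - k^-1 != 0.
  apply: contra k2; rewrite subr_eq0 => /eqP kE.
  by rewrite expr2 {1}kE mulVf.
(* The points [k] and [1/k] share a spectral parameter: reciprocal pairs give plus or minus
   [k - 1/k], equal pairs give 0. *)
have W1 := jost_wronskian JW Jg k0 i0 (esym kC).
have W2 := jost_wronskian JW Jg i0 i0 erefl.
have W3 := jost_wronskian JW Jg k0 k0 erefl.
have W4 := jost_wronskian JW Jg i0 k0 kC.
rewrite (mulVf k0) expr1n mul1r in W1; rewrite subrr mulr0 in W2.
rewrite subrr mulr0 in W3; rewrite (mulfV k0) expr1n mul1r in W4.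
move: W1 W2 W3 W4; set a := evalmx (g 0%N) k; set a' := evalmx (g 0%N) k^-1.
set b := evalmx (g 1%N) k; set b' := evalmx (g 1%N) k^-1.
set as_ := evalmx _ k; set as' := evalmx (sharpmx (g 0%N)) k^-1.
set bs := evalmx _ k; set bs' := evalmx (sharpmx (g 1%N)) k^-1.
move=> W1 W2 W3 W4.
have AB : block_mx (- (k^-1 *: bs')) as' (k *: bs) (- as_)
    *m block_mx a a' (k *: b) (k^-1 *: b') = (k - k^-1)%:M.
  rewrite mulmx_block scalar_mx_block !mulNmx -!scalemxAl -!scalemxAr.
  congr block_mx.
  - by rewrite addrC W1.
  - by rewrite addrC W2 raddf0.
  - by apply/eqP; rewrite subr_eq0 eq_sym -subr_eq0 W3 raddf0.
  - by rewrite -opprB W4 -raddfN opprB.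
(* A one-sided inverse of a square matrix is two-sided; the upper left block of the reversed product
   is the claim. *)
have BA : block_mx a a' (k *: b) (k^-1 *: b')
    *m ((k - k^-1)^-1 *: block_mx (- (k^-1 *: bs')) as' (k *: bs) (- as_)) = 1%:M.
  by apply: mulmx1C; rewrite -scalemxAl AB scale_scalar_mx mulVf.
have := congr1 (fun M => (k - k^-1) *: ulsubmx M) BA.
rewrite scale_block_mx mulmx_block scalar_mx_block !block_mxKul.
rewrite -!scalemxAr -scalerDr scalerA (mulfV c0) scale1r.
by rewrite mulmxN -!scalemxAr addrC scale_scalar_mx mulr1.
Qed.

(** * Recovering the coefficients *)

Lemma subr_exchange (V : zmodType) (s t u v : V) : u - v = s - t -> s - u = t - v.
Proof. by move=> E; apply/eqP; rewrite subr_eq addrAC -addrA E addrC subrK. Qed.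

Lemma subr_cancel (V : zmodType) (a s t u v : V) :
  a + s + t = a + u + v -> v - t + (u - s) = 0.
Proof.
rewrite -!addrA => /addrI E.
by rewrite addrA addrACA [v + u]addrC -E -opprD [t + s]addrC subrr.
Qed.

Lemma scaleX_mx_eq0 (R : realType) d (A : 'M[{poly R[i]}]_d) :
  'X *: A = 0 -> A = 0.
Proof.
move=> A0; apply/matrixP => i j; move/matrixP/(_ i j): A0.
rewrite [LHS]mxE [RHS]mxE => /eqP.
by rewrite mulf_eq0 polyX_eq0 /= => /eqP ->; rewrite mxE.
Qed.

Lemma det_neq0 (R : realType) d (P : 'M[{poly R[i]}]_d) k :
  ((\det P).[k] != 0) = (evalmx P k \in unitmx).
Proof. by rewrite unitmxE unitfE -[_.[k]]/(horner_eval k _) -det_map_mx. Qed.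

Lemma det_poly_neq0 (R : realType) d (P : 'M[{poly R[i]}]_d) k :
  evalmx P k \in unitmx -> \det P != 0.
Proof. by rewrite -det_neq0; apply: contraNneq => ->; rewrite horner0. Qed.

(* [H = C^* f'_1 - f_1] satisfies [psi(l)^* H(k) = H(l)^* psi(k)] for [l = k] and
   [l = k^-1], so [H psi^-1] is hermitian on the real line and invariant under
   [k -> k^-1]. *)
Lemma jost_companion (R : realType) d q (V1 V2 : coefs R d) g1 g2 C :
  class_J q V1 -> class_J q V2 ->
  jost_poly (uphalf q) V1 g1 -> jost_poly (uphalf q) V2 g2 ->
  g2 0%N = constmx C *m g1 0%N -> constmx (C ^t*) *m g2 1%N = g1 1%N.
Proof.
move=> J1 J2 Jg1 Jg2 gC.
pose Y : 'M[{poly R[i]}]_d := constmx (C ^t*) *m g2 1%N - g1 1%N.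
(* The factor ['X] gives [X(0) = 0], which will force the constant produced by rigidity to
   vanish. *)
pose X := 'X *: Y.
have XE k : evalmx X k = k *: (C ^t* *m evalmx (g2 1%N) k - evalmx (g1 1%N) k).
  by rewrite evalmxZ evalmxB evalmxM evalmxC hornerX.
(* Both potentials have the same Wronskian value; equating the two and inserting [gC] gives this
   symmetry. *)
have sym (k l : R[i]) : Num.conj l = l -> k != 0 -> l != 0 ->
    l + l^-1 = k + k^-1 ->
    (evalmx (g1 0%N) l) ^t* *m evalmx X k = (evalmx X l) ^t* *m evalmx (g1 0%N) k.
  move=> lR k0 l0 lk.
  have := jost_wronskian J1 Jg1 k0 l0 lk.
  rewrite -(jost_wronskian J2 Jg2 k0 l0 lk) !evalmx_sharp lR gC !evalmxM !evalmxC.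
  rewrite !XE trmxC_scale trmxC_sub !trmxC_mul trmxCK lR.
  rewrite -!scalemxAl -!scalemxAr mulmxBr mulmxBl !scalerBr !mulmxA.
  exact: subr_exchange.
have g0 : evalmx (g1 0%N) 0 \in unitmx := jost_poly_unit 0 J1 Jg1.
pose D := \det (g1 0%N) * ('X * ('X^2 - 1)).
have D0 : D != 0.
  rewrite !mulf_neq0 ?polyX_eq0 ?(det_poly_neq0 g0) //.
  by rewrite -size_poly_eq0 size_XnsubC.
(* Natural numbers serve as real test points; [D] excludes 0, 1, -1 and the zeros of
   [\det (g1 0)]. *)
pose P (k : R[i]) := (exists n : nat, k = n%:R) /\ D.[k] != 0.
have Pd : zariski_dense P.
  by apply: zariski_denseI D0 (zariski_dense_seq _) => m n /eqP; rewrite eqr_nat => /eqP.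
have PE k : P k ->
    [/\ Num.conj k = k, k != 0, k ^+ 2 != 1 & evalmx (g1 0%N) k \in unitmx].
  move=> [[n kn]]; rewrite !hornerM hornerD hornerN hornerC hornerXn hornerX.
  rewrite !mulf_eq0 !negb_or det_neq0 subr_eq0 => /and3P[ku k0 k2].
  by split=> //; rewrite kn conjC_nat.
have [||C0 XC] := reflection_rigidity Pd g0 (X := X) (G := sharpmx (g1 1%N)).
- move=> k /PE[_ k0 k2 _]; split=> //; exact: jost_bezout J1 Jg1 k0 k2.
- move=> k /PE[kR k0 _]; set A := evalmx (g1 0%N) k => ku.
  pose M := evalmx X k *m invmx A.
  have MA : M *m A = evalmx X k by rewrite mulmxKV.
  have AU : A ^t* \in unitmx by rewrite map_unitmx unitmx_tr.
  (* [sym] with [l = k] makes [M] hermitian; with [l = 1/k] it then shows that [M] also serves at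
     [1/k]. *)
  have MH : M ^t* = M.
    apply: (can_inj (mulKmx AU)); apply: (can_inj (mulmxK ku)).
    rewrite /= -trmxC_mul -[RHS]mulmxA !MA; apply/esym; exact: sym.
  exists M; first by [].
  have kiR : Num.conj k^-1 = k^-1 by rewrite fmorphV /= kR.
  have := sym k k^-1 kiR k0.
  rewrite invr_eq0 invrK addrC => /(_ k0 erefl); rewrite -MA mulmxA.
  move/(can_inj (mulmxK ku))/(congr1 (fun B => B ^t*)).
  by rewrite trmxC_mul !trmxCK MH.
have C00 : C0 = 0.
  apply: (can_inj (mulmxK g0)); rewrite mul0mx.
  by have := XE 0; rewrite scale0r XC evalmxM evalmxC.
apply/eqP; rewrite -subr_eq0; apply/eqP/scaleX_mx_eq0.
by rewrite -[LHS]/X XC C00 map_mx0 mul0mx.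
Qed.

(** [S = A + B] and [D = A - B] anticommute, so [D S D] has trace 0. Its diagonal entries are the
    values of the positive form [S] on the columns of [D], so these columns vanish. *)
Lemma posdefmx_sqr_inj (R : realType) d (A B : 'M[R[i]]_d) :
  posdefmx A -> posdefmx B -> A *m A = B *m B -> A = B.
Proof.
move=> [Ah Ap] [Bh Bp] AB; pose D := A - B; pose S := A + B.
have Dh : D ^t* = D by rewrite trmxC_sub !hermsymmxE.
have SD : S *m D = - (D *m S).
  rewrite mulmxDl mulmxBl !mulmxBr !mulmxDr AB addrC addrA subrK opprB.
  by rewrite [B *m B + _]addrC opprD addrA addrAC addrK.
have S0 (v : 'cV[R[i]]_d) : v != 0 -> 0 < (v ^t* *m S *m v) 0 0.
  by move=> v0; rewrite mulmxDr mulmxDl mxE addr_gt0 ?Ap ?Bp.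
have Dc i : (D *m S *m D) i i = ((col i D) ^t* *m S *m col i D) 0 0.
  rewrite colE trmxC_mul Dh trmx_delta map_delta_mx -!mulmxA -rowE !mulmxA -colE.
  by rewrite [RHS]mxE [RHS]mxE.
have Dge i : 0 <= (D *m S *m D) i i.
  rewrite Dc; have [->|/S0/ltW//] := eqVneq (col i D) 0.
  by rewrite mulmx0 mxE.
have trN : \tr (D *m S *m D) = - \tr (D *m S *m D).
  have DS : D *m S = - (S *m D) by rewrite SD opprK.
  by rewrite [LHS]mxtrace_mulC [in LHS]DS mulmxN mulmxA raddfN.
have tr0 : \tr (D *m S *m D) = 0.
  by move/eqP: trN; rewrite -addr_eq0 -mulr2n mulrn_eq0 /= => /eqP.
apply/eqP; rewrite -subr_eq0 -/D; apply/eqP/matrixP => i j.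
have /(_ j isT)/eqP := psumr_eq0P (fun i (_ : true) => Dge i) tr0.
rewrite Dc; have [Dj _|/S0/gt_eqF-> //] := eqVneq (col j D) 0.
by have := congr1 (fun v : 'cV__ => v i 0) Dj; rewrite [LHS]mxE => ->; rewrite !mxE.
Qed.

Lemma posdefmx_unitary_conj (R : realType) d (A C : 'M[R[i]]_d) :
  C *m C ^t* = 1%:M -> posdefmx A -> posdefmx (C *m A *m C ^t*).
Proof.
move=> CU [Ah Ap]; split.
  apply/is_hermitianmxP; rewrite expr0 scale1r !trmxC_mul trmxCK.
  by rewrite (hermsymmxE Ah) mulmxA.
move=> v v0; rewrite !mulmxA -[v ^t* *m C]trmxCK trmxC_mul trmxCK -!mulmxA !mulmxA.
rewrite -mulmxA; apply: Ap; apply: contra v0 => /eqP Cv.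
by rewrite -[v]mul1mx -CU -mulmxA Cv mulmx0.
Qed.

(** Each recurrence step yields [cb] and only the product of [ca] with the next [g]. At [k = 0] this
    product contains the square of [ca], and positivity selects the root. *)
Lemma jost_peel (R : realType) d q (V1 V2 : coefs R d) g1 g2 C :
  class_J q V1 -> class_J q V2 ->
  jost_poly (uphalf q) V1 g1 -> jost_poly (uphalf q) V2 g2 ->
  C *m C ^t* = 1%:M ->
  g2 0%N = constmx C *m g1 0%N -> g2 1%N = constmx C *m g1 1%N ->
  forall x, [/\ g2 x = constmx C *m g1 x,
    ca V2 x = C *m ca V1 x *m C ^t* & cb V2 x.+1 = C *m cb V1 x.+1 *m C ^t*].
Proof.
move=> J1 J2 Jg1 Jg2 CU gC0 gC1.
have CU' : C ^t* *m C = 1%:M := mulmx1C CU.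
have [a1 _ _ _] := J1; have [a2 _ _ _] := J2.
have pos q' V x : @class_J R d q' V -> posdefmx (ca V x.+1).
  by move=> [_ /(_ x.+1 isT)[]].
suff H x : [/\ g2 x = constmx C *m g1 x, g2 x.+1 = constmx C *m g1 x.+1,
    ca V2 x = C *m ca V1 x *m C ^t* & cb V2 x.+1 = C *m cb V1 x.+1 *m C ^t*].
  by move=> x; case: (H x).
have bE y : g2 y = constmx C *m g1 y -> g2 y.+1 = constmx C *m g1 y.+1 ->
    ca V2 y = C *m ca V1 y *m C ^t* ->
    cb V2 y.+1 = C *m cb V1 y.+1 *m C ^t* /\
    constmx (ca V2 y.+1) *m g2 y.+2 = constmx (C *m ca V1 y.+1) *m g1 y.+2.
  move=> gy gy1 ay; have [_ gE1] := Jg1; have [_ gE2] := Jg2.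
  pose B := cb V2 y.+1 *m C - C *m cb V1 y.+1.
  pose A := constmx (ca V2 y.+1) *m g2 y.+2 - constmx (C *m ca V1 y.+1) *m g1 y.+2.
  have E : 'X *: (constmx B *m g1 y.+1) + 'X^2 *: A = 0.
    have := congr1 (mulmx (constmx C)) (gE1 y); rewrite -scalemxAr -gy1 -gE2.
    rewrite !mulmxDr -!scalemxAr gy gy1 ay !mulmxA -!map_mxM -[C *m _ *m _ *m C]mulmxA.
    rewrite CU' mulmx1; rewrite /A /B map_mxB mulmxBl !scalerBr.
    exact: subr_cancel.
  have E1 : constmx B *m g1 y.+1 + 'X *: A = 0.
    by apply: scaleX_mx_eq0; rewrite scalerDr scalerA.
  (* At [k = 0] only [B] times the invertible [g1 y.+1] remains. *)
  have B0 : B = 0.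
    have := congr1 (fun P => evalmx P 0) E1.
    rewrite evalmxD evalmxZ hornerX scale0r addr0 evalmxM evalmxC => B0.
    apply: (can_inj (mulmxK (jost_poly_unit y.+1 J1 Jg1))).
    by rewrite mul0mx B0; apply/matrixP => i j; rewrite !mxE horner0.
  have A0 : A = 0.
    by apply: scaleX_mx_eq0; rewrite -E1 B0 map_mx0 mul0mx add0r.
  split; last by apply/eqP; rewrite -subr_eq0 -[_ - _]/A A0.
  have /eqP := B0; rewrite subr_eq0 => /eqP <-.
  by rewrite -mulmxA CU mulmx1.
elim: x => [|x [gx gx1 ax bx]].
  have a0 : ca V2 0 = C *m ca V1 0 *m C ^t* by rewrite a1 a2 mulmx1 CU.
  by have [] := bE _ gC0 gC1 a0.
have [_ AE] := bE _ gx gx1 ax.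
have aC : C *m ca V1 x.+1 *m C ^t* *m C = C *m ca V1 x.+1.
  by rewrite -mulmxA CU' mulmx1.
have ax1 : ca V2 x.+1 = C *m ca V1 x.+1 *m C ^t*.
  apply: posdefmx_sqr_inj; first exact: pos J2.
    exact: posdefmx_unitary_conj CU (pos _ _ _ J1).
  have := congr1 (fun P => evalmx P 0) AE; rewrite !evalmxM !evalmxC.
  rewrite (jost_poly_at0 _ Jg1) (jost_poly_at0 _ Jg2) gx1 evalmxM evalmxC !mulmxA.
  move/(can_inj (mulmxK (jost_poly_unit x.+1 J1 Jg1))) => a2C.
  have a2E : ca V2 x.+1 *m ca V2 x.+1 = ca V2 x.+1 *m ca V2 x.+1 *m C *m C ^t*.
    by rewrite -mulmxA CU mulmx1.
  rewrite a2E a2C aC; reflexivity.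
have gx2 : g2 x.+2 = constmx C *m g1 x.+2.
  have aU : constmx (ca V2 x.+1) \in unitmx by rewrite map_unitmx (class_J_unit _ J2).
  apply: (can_inj (mulKmx aU)); by rewrite AE mulmxA -map_mxM ax1 aC.
by have [b _] := bE _ gx1 gx2 ax1; split.
Qed.

(** * Degree of the Jost matrix and the S-matrix *)

Definition sizemx_le (R : realType) d (A : 'M[{poly R[i]}]_d) n : Prop :=
  forall i j, (size (A i j) <= n)%N.

Lemma sizemx_leW (R : realType) d (A : 'M[{poly R[i]}]_d) m n :
  (m <= n)%N -> sizemx_le A m -> sizemx_le A n.
Proof. by move=> mn Am i j; apply: leq_trans mn. Qed.

Lemma sizemx_leD (R : realType) d (A B : 'M[{poly R[i]}]_d) n :
  sizemx_le A n -> sizemx_le B n -> sizemx_le (A + B) n.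
Proof.
move=> An Bn i j; rewrite mxE; apply: leq_trans (size_polyD _ _) _.
by rewrite geq_max An Bn.
Qed.

Lemma sizemx_leB (R : realType) d (A B : 'M[{poly R[i]}]_d) n :
  sizemx_le A n -> sizemx_le B n -> sizemx_le (A - B) n.
Proof.
move=> An Bn; apply: sizemx_leD => // i j.
by rewrite mxE size_polyN.
Qed.

Lemma sizemx_leXn (R : realType) d (A : 'M[{poly R[i]}]_d) m n :
  sizemx_le A n -> sizemx_le ('X^m *: A) (m + n).
Proof.
move=> An i j; rewrite mxE; apply: leq_trans (size_polyMleq _ _) _.
by rewrite size_polyXn addSn leq_add2l.
Qed.

Lemma sizemx_leMl (R : realType) d (B : 'M[R[i]]_d) (A : 'M[{poly R[i]}]_d) n :
  sizemx_le A n -> sizemx_le (constmx B *m A) n.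
Proof.
move=> An i j; rewrite mxE; apply: (leq_trans (size_sum _ _ _)).
apply/bigmax_leqP => l _; rewrite mxE mul_polyC.
exact: leq_trans (size_scale_leq _ _) (An _ _).
Qed.

Lemma sizemx_leC (R : realType) d (B : 'M[R[i]]_d) n : sizemx_le (constmx B) n.+1.
Proof. by move=> i j; rewrite mxE (leq_trans (size_polyC_leq1 _)). Qed.

(** Each step down in [x] raises the degree by at most 2, starting from the constant [g p]. For odd
    [q] the step to [p - 1] raises it by at most 1. *)
Lemma jost_poly_size (R : realType) d q (W : coefs R d) g x :
  class_J q W -> jost_poly (uphalf q) W g -> sizemx_le (g x) (q - x.*2).+1.
Proof.
move=> JW [gp gE]; have [_ _ abp bdry] := JW; set p := uphalf q in gp abp bdry.
have oneE : 1%:M = constmx 1%:M :> 'M[{poly R[i]}]_d by rewrite map_mx1.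
have size_inv y n : sizemx_le (constmx (ca W y) *m g y) n -> sizemx_le (g y) n.
  move=> /(sizemx_leMl (invmx (ca W y))).
  by rewrite mulmxA -map_mxM mulVmx ?(class_J_unit _ JW) // map_mx1 mul1mx.
have size_out y n : (p < y)%N -> sizemx_le (g y) n.+1.
  by move=> py; rewrite gp // oneE; apply: sizemx_leC.
have rec y : constmx (ca W y) *m g y = g y.+1 + 'X^2 *: g y.+1
    - 'X^1 *: (constmx (cb W y.+1) *m g y.+1) - 'X^2 *: (constmx (ca W y.+1) *m g y.+2).
  have -> : g y.+1 + 'X^2 *: g y.+1 = (1 + 'X^2) *: g y.+1.
    by rewrite scalerDl scale1r.
  by rewrite -gE expr1 addrK addrK.
have gpE : constmx (ca W p) *m g p = 1%:M.
  rewrite rec; have [-> ->] := abp _ (ltnSn p); rewrite !gp //.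
  by rewrite map_mx0 mul0mx scaler0 subr0 -oneE mul1mx addrK.
have gpS n : sizemx_le (g p) n.+1.
  by apply: size_inv; rewrite gpE oneE; apply: sizemx_leC.
have qp : p.*2 = (odd q + q)%N by rewrite /p uphalfK.
clearbody p.
suff H m : forall y, (p.+1 - m <= y)%N -> sizemx_le (g y) (q - y.*2).+1.
  by apply: (H p.+1); rewrite subnn.
elim: m => [|m IHm] y; first by rewrite subn0; apply: size_out.
have [py _|yp] := ltnP p y; first exact: size_out.
have [->//|yNp my] := eqVneq y p.
have {yp}yp : (y < p)%N by rewrite ltn_neqAle yNp.
have [IH1 IH2] : sizemx_le (g y.+1) (q - y.+1.*2).+1 /\
                 sizemx_le (g y.+2) (q - y.+2.*2).+1.
  by move: my; clear -IHm => my; split; apply: IHm; lia.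
apply: size_inv; rewrite rec.
(* For odd [q], [q - p.*2] truncates to 0 and the general step would lose one degree. There
   [ca W p = 1] cancels the terms in [k^2] and leaves [1 - k b_p]. *)
have [y1p|y1p] := eqVneq y.+1 p.
  rewrite y1p; have [oddq|evenq] := boolP (odd q).
    move: bdry; rewrite oddq => -[ap _].
    have gp1 : g p = 1%:M by move: gpE; rewrite ap -oneE mul1mx.
    rewrite ap (gp _ (ltnSn p)) gp1 -oneE mul1mx addrAC addrK.
    have -> : (q - y.*2).+1 = 2%N by move: qp; rewrite oddq -y1p; clear; lia.
    apply: sizemx_leB; first by rewrite oneE; apply: sizemx_leC.
    apply: (@sizemx_leXn _ _ _ 1 1); apply: sizemx_leMl.
    by rewrite oneE; apply: sizemx_leC.
  have -> : (q - y.*2).+1 = 3%N.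
    by move: qp; rewrite (negbTE evenq) -y1p; clear; lia.
  apply: sizemx_leB; first apply: sizemx_leB; first apply: sizemx_leD.
  - exact: gpS.
  - exact/(@sizemx_leXn _ _ _ 2 1)/gpS.
  - exact/(@sizemx_leXn _ _ _ 1 2)/sizemx_leMl/gpS.
  - exact/(@sizemx_leXn _ _ _ 2 1)/sizemx_leMl/size_out.
have y2q : (y.+1.*2 <= q)%N.
  move: qp yp y1p; clear; case: (odd q) => /=; lia.
have E : (q - y.*2).+1 = (2 + (q - y.+1.*2).+1)%N by move: y2q; clear; lia.
have leE : (1 + (q - y.+1.*2).+1 <= (q - y.*2).+1)%N by rewrite E.
apply: sizemx_leB; first apply: sizemx_leB; first apply: sizemx_leD.
- by apply: sizemx_leW IH1; rewrite E leq_addl.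
- by rewrite E; apply: sizemx_leXn.
- exact/(sizemx_leW leE)/sizemx_leXn/sizemx_leMl.
- rewrite E; apply/sizemx_leXn/sizemx_leMl/(sizemx_leW _ IH2).
  by clear; lia.
Qed.

(** The Cayley transforms [(n + i) / (n - i)] of the naturals are infinitely many points of the
    circle. *)
Lemma circle_zariski_dense (R : realType) : zariski_dense (fun k : R[i] => `|k| = 1).
Proof.
pose w n : R[i] := n%:R + 'i.
have wC n : Num.conj (w n) = n%:R - 'i by rewrite rmorphD /= conjC_nat conjCi.
have w0 n : w n != 0.
  rewrite addr_eq0; apply/eqP => /(congr1 (fun z => z ^+ 2 + 1)) /eqP.
  by rewrite sqrrN sqrCi addNr -natrX natr1 pnatr_eq0.
pose z n := w n / Num.conj (w n).
have zI : injective z.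
  move=> m n /eqP; rewrite /z eqr_div ?conjC_eq0 // !wC /w => /eqP E.
  have : 2 * 'i * (n%:R - m%:R) = 0 :> R[i].
    transitivity ((m%:R + 'i) * (n%:R - 'i) - (n%:R + 'i) * (m%:R - 'i) : R[i]).
      by move: (m%:R) (n%:R) ('i) => a b c; ring.
    by rewrite E subrr.
  move/eqP; rewrite !mulf_eq0 pnatr_eq0 (negbTE (neq0Ci _)) /= subr_eq0 eqr_nat.
  by move/eqP.
apply: sub_zariski_dense (zariski_dense_seq zI) => _ [n ->].
by rewrite /z normrM normfV norm_conjC mulfV // normr_eq0.
Qed.

(** The common end of both parts: (i) supplies [C] by rigidity, (ii) supplies [C = 1]. *)
Lemma same_V_of_left_factor (R : realType) d q (V1 V2 : coefs R d) g1 g2 C :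
  class_J q V1 -> class_J q V2 ->
  jost_poly (uphalf q) V1 g1 -> jost_poly (uphalf q) V2 g2 ->
  g2 0%N = constmx C *m g1 0%N -> same_V V1 V2.
Proof.
move=> J1 J2 Jg1 Jg2 gC0; have gC1 := jost_companion J1 J2 Jg1 Jg2 gC0.
have [a1 _ _ _] := J1; have [a2 _ _ _] := J2.
(* Evaluate [gC1] at [k = 0]: there [g 1] and [g 0] agree because [a_0 = 1], and [g1 0] is
   invertible. *)
have CU' : C ^t* *m C = 1%:M.
  apply: (can_inj (mulmxK (jost_poly_unit 0 J1 Jg1))).
  rewrite mul1mx -mulmxA -(evalmxC C 0) -evalmxM -gC0.
  have := congr1 (fun P => evalmx P 0) gC1; rewrite evalmxM evalmxC.
  by rewrite (jost_poly_at0 _ Jg1) (jost_poly_at0 _ Jg2) a1 a2 !mul1mx evalmxC.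
have CU : C *m C ^t* = 1%:M := mulmx1C CU'.
have gC1' : g2 1%N = constmx C *m g1 1%N.
  by rewrite -gC1 mulmxA -map_mxM CU map_mx1 mul1mx.
have peel := jost_peel J1 J2 Jg1 Jg2 CU gC0 gC1'.
have C1 : C = 1%:M.
  have [+ _ _] := peel (uphalf q).+1.
  have [-> // _] := Jg1; have [-> // _] := Jg2; rewrite mulmx1.
  by move/(congr1 (fun P => evalmx P 0)); rewrite evalmx1 evalmxC.
apply/(same_VP a1 a2) => -[//|x] _; have [_ ax _] := peel x.+1.
by have [_ _ bx] := peel x; rewrite ax bx C1 trmx1 map_mx1 !mul1mx !mulmx1.
Qed.

(** On the circle [conj k = 1/k], so equal S-matrices say that [psi2 psi1^-1] agrees at [k] and
    [1/k]. [D] excludes singular points and 1, -1, where [smatrix] is a limit. *)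
Lemma smatrix_left_factor (R : realType) d q (V1 V2 : coefs R d) psi1 psi2 :
  class_J q V1 -> class_J q V2 -> jost_matrix q V1 psi1 -> jost_matrix q V2 psi2 ->
  (forall k : R[i], `|k| = 1 -> smatrix psi1 k = smatrix psi2 k) ->
  exists C, psi2 = constmx C *m psi1.
Proof.
move=> J1 J2 Jpsi1 Jpsi2 SE.
have [g1 Jg1] := jost_poly_exists J1; have [g2 Jg2] := jost_poly_exists J2.
have psi1E := jost_matrix_poly J1 Jg1 Jpsi1.
have psi2E := jost_matrix_poly J2 Jg2 Jpsi2.
have u1 : evalmx psi1 0 \in unitmx by rewrite psi1E (jost_poly_unit 0 J1 Jg1).
have u2 : evalmx psi2 0 \in unitmx by rewrite psi2E (jost_poly_unit 0 J2 Jg2).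
pose D : {poly R[i]} := \det psi1 * (\det psi2 * ('X^2 - 1)).
have D0 : D != 0.
  rewrite !mulf_neq0 ?(det_poly_neq0 u1) ?(det_poly_neq0 u2) //.
  by rewrite -size_poly_eq0 size_XnsubC.
have Pd := zariski_denseI D0 (@circle_zariski_dense R).
have PE k : `|k| = 1 /\ D.[k] != 0 -> [/\ k != 0, k ^+ 2 != 1, Num.conj k = k^-1,
    evalmx psi1 k \in unitmx & evalmx psi2 k \in unitmx].
  move=> [k1]; rewrite !hornerM hornerD hornerN hornerC hornerXn.
  rewrite !mulf_eq0 !negb_or !det_neq0 subr_eq0 => /and3P[ku1 ku2 k2].
  split=> //; first by rewrite -normr_gt0 k1.
  by rewrite invC_norm k1 expr1n invr1 mul1r.
apply: (reflection_rigidity Pd u1 (G := sharpmx (g1 1%N)))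
  => k /[dup] Pk /PE[k0 k2 kC ku1 ku2].
  by split=> //; rewrite psi1E; apply: jost_bezout J1 Jg1 k0 k2.
exists (evalmx psi2 k *m invmx (evalmx psi1 k)); first by rewrite mulmxKV.
have := SE k (proj1 Pk); rewrite /smatrix.
have -> : (k == 1) || (k == -1) = false by apply/negbTE; rewrite -sqrf_eq1.
by rewrite kC -mulmxA => ->; rewrite mulKVmx.
Qed.

Lemma evalmx_interpolation (R : realType) d n (A B : 'M[{poly R[i]}]_d)
    (zeta : 'I_n -> R[i]) :
  injective zeta -> sizemx_le A n -> sizemx_le B n ->
  (forall j, evalmx A (zeta j) = evalmx B (zeta j)) -> A = B.
Proof.
move=> zI An Bn AB; apply/matrixP => i j; apply/eqP; rewrite -subr_eq0; apply/eqP.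
apply: (@roots_geq_poly_eq0 _ _ [seq zeta l | l <- enum 'I_n]).
- apply/allP => _ /mapP[l _ ->]; have /matrixP/(_ i j) := AB l; rewrite !mxE => E.
  by rewrite /root hornerD hornerN E subrr.
- by rewrite map_inj_uniq ?enum_uniq.
- rewrite size_map size_enum_ord (leq_trans (size_polyD _ _)) //.
  by rewrite geq_max size_polyN An Bn.
Qed.

Theorem theorem1p5 (R : realType) (d q : nat) (d_ge1 : (1 <= d)%N)
    (q_ge1 : (1 <= q)%N) (V1 V2 : coefs R d) (psi1 psi2 : 'M[{poly R[i]}]_d)
    (J1 : class_J q V1) (J2 : class_J q V2)
    (psi1P : jost_matrix q V1 psi1) (psi2P : jost_matrix q V2 psi2) :
  ((forall k : R[i], `|k| = 1 -> smatrix psi1 k = smatrix psi2 k) ->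
     same_V V1 V2) /\
  (forall zeta : 'I_q.+1 -> R[i], injective zeta ->
     (forall j, evalmx psi1 (zeta j) = evalmx psi2 (zeta j)) ->
     same_V V1 V2).
Proof.
have [g1 Jg1] := jost_poly_exists J1; have [g2 Jg2] := jost_poly_exists J2.
have psi1E := jost_matrix_poly J1 Jg1 psi1P.
have psi2E := jost_matrix_poly J2 Jg2 psi2P.
split=> [SE|zeta zI psiE].
  have [C psiC] := smatrix_left_factor J1 J2 psi1P psi2P SE.
  by apply: (same_V_of_left_factor (C := C) J1 J2 Jg1 Jg2); rewrite -psi1E -psi2E.
apply: (same_V_of_left_factor (C := 1%:M) J1 J2 Jg1 Jg2).
rewrite map_mx1 mul1mx -psi1E -psi2E; apply/esym.
apply: (evalmx_interpolation zI) psiE.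
  by have := jost_poly_size 0 J1 Jg1; rewrite psi1E subn0.
by have := jost_poly_size 0 J2 Jg2; rewrite psi2E subn0.
Qed.
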